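(* Let $\mathcal{K}$ and $\mathcal{K}'$ be two simplicial complexes over a set $S$. Then the Hausdorff (pseudo-)distance between $|\mathcal{K}|_1$ and $|\mathcal{K}'|_1$ with respect to the metric $d(\alpha,\beta)=\frac12\sum_{s\in S}|\alpha(s)-\beta(s)|$ equals the Hausdorff (pseudo-)distance between $L(\mathcal{K})$ and $L(\mathcal{K}')$: $$d\left(|\mathcal{K}|_1,|\mathcal{K}'|_1\right)=d\left(L(\mathcal{K}),L(\mathcal{K}')\right).$$
   Context: $\mathcal{P}_f^*(S)$ is the collection of all non-empty finite subsets of $S$. A simplicial complex over $S$ is a non-empty collection $\mathcal{K}\subset\mathcal{P}_f^*(S)$ such that every non-empty subset of an element of $\mathcal{K}$ belongs to $\mathcal{K}$. $\Omega=[0,1]$ with Lebesgue measure $\lambda$. $L(\mathcal{K})$ is the set of measurable maps $f:\Omega\to S$, identified when equal almost everywhere, such that $f(\Omega)\in\mathcal{K}$, where $f(\Omega)$ denotes the set $\{s\in S : \lambda(f^{-1}(s))>0\}$ and $f$ takes its values in this set almost everywhere. The metric is $d(f,g)=\lambda(\{t\in\Omega : f(t)\neq g(t)\})$. $|\mathcal{K}|_1$ is the set of all $\alpha:S\to[0,1]$ with $\sum_{s\in S}\alpha(s)=1$ whose support $\{s:\alpha(s)\neq0\}$ belongs to $\mathcal{K}$. For bounded non-empty subsets $X,Y$ of a metric space, the Hausdorff (pseudo-)distance is $d(X,Y)=\max(\delta(X,Y),\delta(Y,X))$ with $\delta(X,Y)=\sup_{x\in X}\inf_{y\in Y}d(x,y)$.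 *)

(* Defs.v *)
From HB Require Import structures.
From mathcomp Require Import all_boot all_order all_algebra.
From mathcomp Require Import all_classical all_reals all_analysis.

Set Implicit Arguments.
Unset Strict Implicit.
Unset Printing Implicit Defensive.
Import Order.TTheory GRing.Theory Num.Theory.

Local Open Scope classical_set_scope.
Local Open Scope ring_scope.
Local Open Scope quotient_scope.
Local Open Scope ereal_scope.

Definition is_simplicial_complex (S : Type) (K : set (set S)) : Prop :=
  [/\ K !=set0,
      forall A, K A -> finite_set A /\ A !=set0 &
      forall A B, K A -> B `<=` A -> B !=set0 -> K B].

(* The distances below are the library's [\bar R]-valued measures and sums, so
   suprema and infima are taken in [\bar R], where they always exist. *)
Definition hausdorff_excess (R : realType) (T : Type) (d : T -> T -> \bar R)
    (X Y : set T) : \bar R :=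
  ereal_sup [set ereal_inf [set d x y | y in Y] | x in X].

Definition hausdorff_dist (R : realType) (T : Type) (d : T -> T -> \bar R)
    (X Y : set T) : \bar R :=
  Order.max (hausdorff_excess d X Y) (hausdorff_excess d Y X).

Definition geometric_realization (R : realType) (S : choiceType)
    (K : set (set S)) : set (S -> R) :=
  [set a | [/\ forall s, (0 <= a s <= 1)%R,
               \esum_(s in [set: S]) (a s)%:E = 1 &
               K [set s | a s != 0%R]]].

Definition half_l1_dist (R : realType) (S : choiceType) (a b : S -> R) :
    \bar R :=
  (2^-1)%:E * \esum_(s in [set: S]) `|a s - b s|%:E.

Section unit_interval.
Variable R : realType.

Definition Omega : Type := set_type (`[0%R, 1%R]%classic : set R).

Definition Omega_val (t : Omega) : R := val t.

Lemma Omega_val_inj : injective Omega_val.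
Proof. exact: val_inj. Qed.

Lemma Omega_range : range Omega_val = (`[0%R, 1%R]%classic : set R).
Proof.
apply/seteqP; split => [_ [t _ <-]|x x01]; first exact: (set_mem (valP t)).
by exists (SigSub (mem_set x01)).
Qed.

HB.instance Definition _ := Choice.on Omega.

Fact Omega_point : Omega.
Proof.
by exists 0%R; rewrite inE /= in_itv /= lexx ler01.
Qed.

HB.instance Definition _ := isPointed.Build Omega Omega_point.

(* The (complete) Lebesgue sigma-algebra of the line, not only the Borel one. *)
Definition Lebesgue_measurable : set (set R) :=
  (@wlength R idfun)^*%mu.-cara.-measurable.

Definition Omega_measurable : set (set Omega) :=
  [set A | Lebesgue_measurable (Omega_val @` A)].

Fact Omega_measurable0 : Omega_measurable set0.
Proof. by rewrite /Omega_measurable /= image_set0; exact: measurable0. Qed.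

Lemma Lebesgue_measurable_itv01 : Lebesgue_measurable `[0%R, 1%R]%classic.
Proof.
by rewrite /Lebesgue_measurable; apply: sub_caratheodory; exact: measurable_itv.
Qed.

Fact Omega_measurableC A : Omega_measurable A -> Omega_measurable (~` A).
Proof.
rewrite /Omega_measurable /= => mA.
have -> : Omega_val @` (~` A) = `[0%R, 1%R]%classic `\` Omega_val @` A.
  rewrite -Omega_range; apply/seteqP; split => [_ [t nAt <-]|_ [[t _ <-] nAt]].
    by split; [exists t|move=> [u Au /Omega_val_inj ut]; apply: nAt; rewrite -ut].
  by exists t => // At; apply: nAt; exists t.
by apply: measurableD => //; exact: Lebesgue_measurable_itv01.
Qed.

Fact Omega_measurable_bigcup (F : (set Omega)^nat) :
  (forall i, Omega_measurable (F i)) -> Omega_measurable (\bigcup_i F i).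
Proof.
move=> mF; rewrite /Omega_measurable /= image_bigcup.
exact: (bigcupT_measurable _ mF).
Qed.

HB.instance Definition _ := @isMeasurable.Build default_measure_display Omega
  Omega_measurable Omega_measurable0 Omega_measurableC Omega_measurable_bigcup.

Definition lambda (A : set Omega) : \bar R :=
  completed_lebesgue_measure (Omega_val @` A).

Fact lambda0 : lambda set0 = 0.
Proof. by rewrite /lambda image_set0 measure0. Qed.

Fact lambda_ge0 A : 0 <= lambda A.
Proof. exact: measure_ge0. Qed.

Fact lambda_semi_sigma_additive : semi_sigma_additive lambda.
Proof.
move=> F mF tF mUF; rewrite /lambda image_bigcup.
apply: measure_semi_sigma_additive => //.
- apply/trivIsetP => i j _ _ ij; apply/seteqP; split => // x [[t Ft <-]].
  move=> [u Fu /Omega_val_inj ut]; rewrite ut in Fu.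
  have /trivIsetP/(_ i j I I ij) := tF.
  by rewrite -subset0 => /(_ t); apply.
- by rewrite -image_bigcup.
Qed.

HB.instance Definition _ := isMeasure.Build _ _ _ lambda
  lambda0 lambda_ge0 lambda_semi_sigma_additive.

Lemma lambda_setT : lambda setT = 1.
Proof.
rewrite /lambda Omega_range.
have -> : completed_lebesgue_measure (`[0%R, 1%R]%classic : set R) =
          lebesgue_measure (`[0%R, 1%R]%classic : set R) by [].
by rewrite lebesgue_measure_itv /= lte01 oppr0 adde0.
Qed.

Lemma lambda_le_ae (A B : set Omega) :
  (\forall t \ae lambda, A t -> B t) -> lambda A <= lambda B.
Proof.
move=> [N [mN N0 subN]].
have AB : A `<=` B `|` N.
  move=> t At; have [Bt|nBt] := pselect (B t); [by left|right].
  by apply: subN => /= /(_ At).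
pose mu := [the {outer_measure set _ -> \bar R} of (@wlength R idfun)^*%mu].
have -> : lambda A = mu (Omega_val @` A) by [].
apply: (@le_trans _ _ (mu (Omega_val @` B `|` Omega_val @` N))).
  by apply: le_outer_measure; rewrite -image_setU; exact: image_subset.
apply: le_trans (outer_measureU2 _ _ _) _.
by have -> : mu (Omega_val @` N) = 0; rewrite ?adde0.
Qed.

End unit_interval.

Section measurable_maps.
Variables (R : realType) (S : choiceType).

(* [S] carries its discrete sigma-algebra; it is not made a [measurableType]
   because these are pointed. *)
Record measurable_map := MeasurableMap {
  measurable_map_fun :> Omega R -> S ;
  measurable_mapP : forall A : set S, measurable (measurable_map_fun @^-1` A) }.

HB.instance Definition _ := gen_eqMixin measurable_map.
HB.instance Definition _ := gen_choiceMixin measurable_map.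

Definition ae_eq_map (f g : measurable_map) : bool :=
  `[< f = g %[ae @lambda R] >].

Fact ae_eq_map_refl : reflexive ae_eq_map.
Proof. by move=> f; apply/asboolP/ae_eq_refl. Qed.

Fact ae_eq_map_sym : symmetric ae_eq_map.
Proof.
by move=> f g; apply/asboolP/asboolP => fg; exact: ae_eq_sym.
Qed.

Fact ae_eq_map_trans : transitive ae_eq_map.
Proof.
by move=> g f h /asboolP fg /asboolP gh; apply/asboolP/(ae_eq_trans fg gh).
Qed.

Canonical ae_eq_map_equiv :=
  EquivRel ae_eq_map ae_eq_map_refl ae_eq_map_sym ae_eq_map_trans.

Definition Lmap : Type := {eq_quot ae_eq_map}.
HB.instance Definition _ := Choice.on Lmap.
HB.instance Definition _ := EqQuotient.on Lmap.

Definition essential_image (f : measurable_map) : set S :=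
  [set s | 0 < lambda (f @^-1` [set s])].

Definition random_complex (K : set (set S)) : set Lmap :=
  [set f | K (essential_image (repr f)) /\
           \forall t \ae @lambda R, essential_image (repr f) (repr f t)].

Definition disagreement_dist (f g : Lmap) : \bar R :=
  lambda [set t | repr f t <> repr g t].

(* [essential_image] and [disagreement_dist] do not depend on the choice of
   representatives. *)
Lemma repr_Lmap_ae (f : measurable_map) :
  \forall t \ae @lambda R, repr (\pi_Lmap f) t = f t.
Proof.
have /eqmodP/asboolP : \pi_Lmap (repr (\pi_Lmap f)) = \pi_Lmap f.
  by rewrite reprK.
by apply: filterS => t; exact.
Qed.

Lemma essential_image_pi (f : measurable_map) :
  essential_image (repr (\pi_Lmap f)) = essential_image f.
Proof.
apply/seteqP; split=> s; rewrite /essential_image /= => /lt_le_trans; apply;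
  by apply: lambda_le_ae; apply: filterS (repr_Lmap_ae f) => t /= ->.
Qed.

Lemma disagreement_dist_pi (f g : measurable_map) :
  disagreement_dist (\pi_Lmap f) (\pi_Lmap g) = lambda [set t | f t <> g t].
Proof.
apply/eqP; rewrite eq_le; apply/andP; split; apply: lambda_le_ae;
  by apply: filterS2 (repr_Lmap_ae f) (repr_Lmap_ae g) => t /= -> ->.
Qed.

End measurable_maps.

(* Main.v *)
Require Import Defs.
From mathcomp Require Import all_boot all_order all_algebra.
From mathcomp Require Import all_classical all_reals all_analysis.
From mathcomp Require Import lra.

(** Send a map [f] to its law [s |-> lambda (f @^-1` [set s])]. This carries
    [L(K)] onto [|K|_1], and it is a submetry for the two distances, which is
    all that the equality of Hausdorff distances requires
    ([hausdorff_excess_submetry]).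

    It does not increase distances. For probability vectors [a] and [b], half
    of the l1-distance equals [1 - \sum_s min (a s) (b s)]
    ([half_l1_distE]); and if [f] and [g] have laws [a] and [b], the set where
    both take the value [s] has measure at most [min (a s) (b s)], so [f] and
    [g] agree on a set of measure at most [\sum_s min (a s) (b s)]
    ([overlap_le]).

    Distances lift. Given [f] with law [a], and a finitely supported
    probability vector [b], some [g] with law [b] attains this bound
    ([exists_coupled_map]): the measure [lambda] takes all intermediate values
    on the subsets of a measurable set ([prob_divisible]), so one can choose
    inside each fibre of [f] over [s] a part of measure [min (a s) (b s)], keep
    [g = f] there, and divide the complement of these parts into pieces which
    give each [s] the mass [b s - min (a s) (b s)] it still lacks
    ([exists_map_with_masses]). Lifting from a constant map also shows that
    every point of [|K|_1] is a law. *)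

Import Order.TTheory GRing.Theory Num.Theory.
Import numFieldNormedType.Exports.

Set Implicit Arguments.
Unset Strict Implicit.
Unset Printing Implicit Defensive.

Local Open Scope classical_set_scope.
Local Open Scope ring_scope.
Local Open Scope quotient_scope.

(** * Hausdorff distances along a submetry *)

(** For fixed [x], the infimum over [Y'] is at most the infimum over [Y] because
    [p] does not increase distances, and at least that infimum because each
    point of [Y'] is represented by a point of [Y] no farther from [x]. As [p]
    maps [X] onto [X'], the suprema are then over the same set of values. *)
Lemma hausdorff_excess_submetry (R : realType) (T T' : Type)
    (d : T -> T -> \bar R) (d' : T' -> T' -> \bar R) (p : T -> T')
    (X Y : set T) (X' Y' : set T') :
  p @` X = X' -> p @` Y `<=` Y' ->
  (forall x y, X x -> Y y -> (d' (p x) (p y) <= d x y)%E) ->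
  (forall x y', X x -> Y' y' -> exists2 y, Y y & (d x y <= d' (p x) y')%E) ->
  hausdorff_excess d X Y = hausdorff_excess d' X' Y'.
Proof.
move=> <- pY d'd lift; rewrite /hausdorff_excess [in RHS]image_comp.
congr ereal_sup; apply: eq_imagel => x Xx /=.
apply/eqP; rewrite eq_le; apply/andP; split.
  apply/ereal_infP => _ [y' Yy' <-]; have [y Yy] := lift x y' Xx Yy'.
  by apply: le_trans; apply: ereal_inf_lbound; exists y.
apply/ereal_infP => _ [y Yy <-]; apply: le_trans (d'd _ _ Xx Yy).
by apply: ereal_inf_lbound; exists (p y) => //; apply: pY; exists y.
Qed.

(** * Half of the l1-distance as one minus the overlap *)

Section Sums.
Variables (R : realType) (S : choiceType).

Lemma esum_seq (r : seq S) (c : S -> R) : uniq r -> (forall s, 0 <= c s) ->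
  (forall s, s \notin r -> c s = 0) ->
  \esum_(s in [set: S]) (c s)%:E = (\sum_(s <- r) c s)%:E.
Proof.
move=> ur c0 cr.
rewrite -sumEFin fsbig_seq// -esum_fset//; last by move=> i _; rewrite lee_fin.
rewrite [RHS]esum_mkcond; apply: eq_esum => s _.
by case: ifPn => //; rewrite notin_setE /= => /negP/cr ->.
Qed.

(** Sum [|x - y| = x + y - 2 min x y] over the common finite support. *)
Lemma half_l1_distE (r : seq S) (a b : S -> R) : uniq r ->
  (forall s, s \notin r -> a s = 0) -> (forall s, s \notin r -> b s = 0) ->
  \sum_(s <- r) a s = 1 -> \sum_(s <- r) b s = 1 ->
  half_l1_dist a b = (1 - \sum_(s <- r) Num.min (a s) (b s))%:E.
Proof.
move=> ur ar br a1 b1; rewrite /half_l1_dist (@esum_seq r)//; last first.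
  by move=> s sr; rewrite ar// br// subrr normr0.
have -> : \sum_(s <- r) `|a s - b s| =
    \sum_(s <- r) (a s + b s - (Num.min (a s) (b s)) *+ 2).
  apply: eq_bigr => s _; have [ab|/ltW ab] := leP (a s) (b s).
    by rewrite ler0_norm; lra.
  by rewrite ger0_norm; lra.
rewrite sumrB big_split/= a1 b1 -EFinM; congr EFin.
by rewrite sumrMnl; lra.
Qed.

End Sums.

(** * Lebesgue measure on the unit interval as a real-valued probability *)

Section RealLambda.
Variable R : realType.
Implicit Types A B : set (Omega R).

(** [lambda] is monotone on all sets, measurable or not, hence at most 1; real
    values allow free subtraction. *)
Definition prob A : R := fine (lambda A).

Lemma lambda_mono A B : A `<=` B -> (lambda A <= lambda B)%E.
Proof. by move=> AB; apply: lambda_le_ae; apply: aeW => t; exact: AB. Qed.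

Lemma probE A : lambda A = (prob A)%:E.
Proof.
have le1 : (lambda A <= 1)%E by rewrite -lambda_setT; exact: lambda_mono.
by rewrite /prob fineK// ge0_fin_numE ?lambda_ge0// (le_lt_trans le1)// ltry.
Qed.

Lemma prob_ge0 A : 0 <= prob A.
Proof. by rewrite -lee_fin -probE lambda_ge0. Qed.

Lemma prob_le_ae A B :
  (\forall t \ae @lambda R, A t -> B t) -> prob A <= prob B.
Proof. by move=> AB; rewrite -lee_fin -!probE; exact: lambda_le_ae. Qed.

Lemma prob_mono A B : A `<=` B -> prob A <= prob B.
Proof. by move=> AB; apply: prob_le_ae; apply: aeW => t; exact: AB. Qed.

Lemma prob_setT : prob setT = 1.
Proof. by rewrite /prob lambda_setT. Qed.

Lemma prob_set0 : prob set0 = 0.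
Proof. by rewrite /prob lambda0. Qed.

Lemma probU A B : measurable A -> measurable B -> A `&` B = set0 ->
  prob (A `|` B) = prob A + prob B.
Proof.
move=> mA mB AB0; apply: EFin_inj.
by rewrite EFinD -!probE [LHS](measureU (@lambda R)).
Qed.

Lemma prob_setID A B : measurable A -> measurable B ->
  prob A = prob (A `&` B) + prob (A `&` ~` B).
Proof.
move=> mA mB; rewrite -probU ?setUIDK//.
- exact: measurableI.
- by apply: measurableI => //; exact: measurableC.
- by rewrite setIACA setICr setI0.
Qed.

Lemma prob_setC A : measurable A -> prob (~` A) = 1 - prob A.
Proof.
by move=> mA; rewrite -prob_setT (prob_setID measurableT mA) !setTI addrC addKr.
Qed.

Lemma prob_bigcup_seq (I : choiceType) (r : seq I) (F : I -> set (Omega R)) :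
  uniq r -> (forall i, measurable (F i)) -> trivIset setT F ->
  prob (\bigcup_(i in [set` r]) F i) = \sum_(i <- r) prob (F i).
Proof.
move=> ur mF tF; apply: EFin_inj; rewrite -probE -sumEFin.
rewrite [LHS](measure_fin_bigcup (@lambda R))//; last first.
  exact: sub_trivIset tF.
by rewrite -fsbig_seq//; apply: eq_bigr => i _; exact: probE.
Qed.

Lemma measurable_below (x : R) :
  measurable [set t : Omega R | Omega_val t <= x].
Proof.
suff : Lebesgue_measurable (@Omega_val R @` [set t | Omega_val t <= x]) by [].
have -> : @Omega_val R @` [set t | Omega_val t <= x] = `[0, 1] `&` `]-oo, x].
  rewrite -Omega_range; apply/seteqP.
  split => [_ [t /= tx <-]|_ [[t _ <-] /= tx]].
    by split; [exists t|rewrite /= in_itv].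
  by exists t => //=; rewrite in_itv /= in tx.
by rewrite /Lebesgue_measurable; apply: sub_caratheodory;
  apply: measurableI; exact: measurable_itv.
Qed.

Lemma prob_between (x y : R) : x <= y ->
  prob [set t | x < Omega_val t <= y] <= y - x.
Proof.
move=> xy; rewrite -lee_fin -probE.
have -> : (y - x)%:E = lebesgue_measure (`]x, y] : set R).
  rewrite lebesgue_measure_itv /= lte_fin; case: ltgtP xy => // ->.
  by rewrite subrr.
pose mu := [the {outer_measure set _ -> \bar R} of (@wlength R idfun)^*%mu].
apply: (@le_outer_measure _ _ mu).
by move=> _ [t /= h <-]; rewrite in_itv.
Qed.

(** [lambda] has no atoms: the measure of the part of [A] below [x] is a
    1-Lipschitz function of [x], by [prob_between], so it takes all values
    between [0] and [prob A]. *)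
Lemma prob_divisible A (c : R) : measurable A -> 0 <= c <= prob A ->
  exists B, [/\ measurable B, B `<=` A & prob B = c].
Proof.
move=> mA /andP[c0 cA].
pose E (x : R) := A `&` [set t | Omega_val t <= x].
have mE x : measurable (E x).
  by apply: measurableI => //; exact: measurable_below.
pose phi x := prob (E x).
have phi_le x y : x <= y -> phi x <= phi y.
  move=> xy; apply: prob_mono => t [At /= tx]; split=> //=.
  exact: le_trans xy.
have phi_lip x y : x <= y -> phi y <= phi x + (y - x).
  move=> xy; rewrite /phi (prob_setID (mE y) (measurable_below x)).
  apply: lerD; first by apply: prob_mono => t [[At _] tx].
  apply: le_trans (prob_between xy); apply: prob_mono => t [[_ /= ty] /negP].
  by rewrite -ltNge => -> /=.
(* Starting at -1, to the left of the interval, makes the lower part empty. *)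
have phi0 : phi (-1) = 0.
  rewrite /phi (_ : E (-1) = set0) ?prob_set0// -subset0 => t [_ /= t1].
  have : (Omega_val t) \in `[0, 1] by move: (valP t); rewrite inE.
  by rewrite in_itv /=; lra.
have phi1 : phi 1 = prob A.
  congr prob; apply/seteqP; split=> [t []//|t At]; split => //=.
  have : (Omega_val t) \in `[0, 1] by move: (valP t); rewrite inE.
  by rewrite in_itv /= => /andP[].
have phi_cont : continuous phi.
  move=> x; apply/cvgrPdist_le => e e0.
  near=> y; have : `|x - y| <= e by near: y; exact: cvgr_dist_le.
  by have [xy|yx] := leP x y;
    [have := phi_lip _ _ xy; have := phi_le _ _ xy
    |have := phi_lip _ _ (ltW yx); have := phi_le _ _ (ltW yx)];
    rewrite !ler_norml; lra.
have [||| x _ phix] := @IVT _ phi (-1) 1 c.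
- lra.
- exact: continuous_subspaceT.
- by rewrite phi0 phi1 min_l ?prob_ge0// max_r ?prob_ge0// c0.
by exists (E x); split => // t [].
Unshelve. all: by end_near.
Qed.

End RealLambda.

(** * Laws of measurable maps and their couplings *)

Section Maps.
Variables (R : realType) (S : choiceType).
Local Notation map := (measurable_map R S).

Definition law (f : map) (s : S) : R := prob (f @^-1` [set s]).

Program Definition constant_map (s : S) : map := @MeasurableMap R S (fun=> s) _.
Next Obligation. by move=> s A; rewrite preimage_cst; case: ifP. Qed.

Lemma preimage_glue (B : set (Omega R)) (f g : map) (A : set S) :
  (fun t => if `[< B t >] then f t else g t) @^-1` A =
  (B `&` f @^-1` A) `|` (~` B `&` g @^-1` A).
Proof.
apply/seteqP; split => t /=; first by case: asboolP; [left|right].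
by case: asboolP; tauto.
Qed.

Lemma measurable_glue (B : set (Omega R)) (mB : measurable B) (f g : map)
    (A : set S) :
  measurable ((fun t => if `[< B t >] then f t else g t) @^-1` A).
Proof.
rewrite preimage_glue; apply: measurableU; apply: measurableI => //.
- exact: measurable_mapP.
- exact: measurableC.
- exact: measurable_mapP.
Qed.

Definition glue B mB (f g : map) : map :=
  MeasurableMap (@measurable_glue B mB f g).

Lemma prob_glue (B : set (Omega R)) (mB : measurable B) (f g : map) C (s : S) :
  measurable C ->
  prob (C `&` glue mB f g @^-1` [set s]) =
  prob (C `&` B `&` f @^-1` [set s]) + prob (C `&` ~` B `&` g @^-1` [set s]).
Proof.
move=> mC; rewrite preimage_glue setIUr !setIA probU//.
- by do ?[apply: measurableI => //]; exact: measurable_mapP.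
- do ?[apply: measurableI => //]; first exact: measurableC.
  exact: measurable_mapP.
- by rewrite -subset0 => t [[[_ ?] _] [[_ ?] _]].
Qed.

(** Cut off from [A] one piece after the other. The conclusion bears on all
    [s], not only those in [r]: in the induction step it says that the rest of
    [A] adds nothing to the mass of the value just served. The value [s0] is
    taken on a null part of [A] only. *)
Lemma exists_map_with_masses (s0 : S) (r : seq S) (A : set (Omega R))
    (w : S -> R) :
  measurable A -> uniq r -> (forall s, 0 <= w s) ->
  (forall s, s \notin r -> w s = 0) -> \sum_(s <- r) w s = prob A ->
  exists h : map, forall s, prob (A `&` h @^-1` [set s]) = w s.
Proof.
elim: r A w => [|x r IH] A w mA ur w0 wr.
  rewrite big_nil => A0; exists (constant_map s0) => s; rewrite (wr s)//.
  by apply/eqP; rewrite eq_le prob_ge0 A0 andbT; apply: prob_mono => t [].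
rewrite big_cons => wA; move: ur => /= /andP[xr ur].
have [|B [mB BA Bx]] := @prob_divisible R A (w x) mA.
  by rewrite w0 -wA lerDl sumr_ge0.
pose w' s := if s == x then 0 else w s.
have [|//||||h hw'] := IH (A `&` ~` B) w'.
- by apply: measurableI => //; exact: measurableC.
- by move=> s; rewrite /w'; case: ifP.
- move=> s sr; rewrite /w'; case: eqP => // /eqP sx.
  by apply: wr; rewrite inE negb_or sx.
- transitivity (\sum_(s <- r) w s).
    rewrite big_seq [RHS]big_seq; apply: eq_bigr => s sr; rewrite /w'.
    by case: eqP => // sx; rewrite -sx sr in xr.
  by move: (prob_setID mA mB); rewrite (setIidr BA) Bx -wA => /addrI.
exists (glue mB (constant_map x) h) => s.
rewrite prob_glue// (setIidr BA) hw' /w'; case: eqVneq => [->|sx].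
  by rewrite preimage_cst mem_set// setIT Bx addr0.
rewrite preimage_cst memNset ?setI0 ?prob_set0 ?add0r// => /= /eqP.
by rewrite eq_sym (negPf sx).
Qed.

Lemma trivIset_sub_fibers (f : map) (F : S -> set (Omega R)) :
  (forall s, F s `<=` f @^-1` [set s]) -> trivIset setT F.
Proof. by move=> Ff i j _ _ [t [/Ff /= <- /Ff /= <-]]. Qed.

(** The maximal coupling of two laws, with one of the two maps prescribed. *)
Lemma exists_coupled_map (s0 : S) (f : map) (r : seq S) (b : S -> R) :
  uniq r -> (forall s, 0 <= b s) -> (forall s, s \notin r -> b s = 0) ->
  \sum_(s <- r) b s = 1 ->
  exists2 g : map, law g = b &
    prob [set t | f t <> g t] <= 1 - \sum_(s <- r) Num.min (law f s) (b s).
Proof.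
move=> ur b0 br b1; pose m s := Num.min (law f s) (b s).
have mr s : s \notin r -> m s = 0.
  by move=> /br bs; rewrite /m bs min_r// prob_ge0.
have /choice[B HB] s :
    exists B, [/\ measurable B, B `<=` f @^-1` [set s] & prob B = m s].
  apply: prob_divisible; first exact: measurable_mapP.
  by rewrite /m le_min prob_ge0 b0 ge_min lexx.
have mB s : measurable (B s) by have [] := HB s.
have Bf s : B s `<=` f @^-1` [set s] by have [] := HB s.
have pB s : prob (B s) = m s by have [] := HB s.
pose D := \bigcup_(s in [set` r]) B s.
have mD : measurable D by apply: fin_bigcup_measurable.
have pD : prob D = \sum_(s <- r) m s.
  by rewrite prob_bigcup_seq//; [apply: eq_bigr|exact: trivIset_sub_fibers Bf].
have [|//||||h hw] := @exists_map_with_masses s0 r (~` D) (fun s => b s - m s).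
- exact: measurableC.
- by move=> s; rewrite subr_ge0 /m ge_min lexx orbT.
- by move=> s sr; rewrite mr// br// subrr.
- by rewrite prob_setC// pD sumrB b1.
exists (glue mD f h).
  apply/funext => s; rewrite /law -[_ @^-1` _]setTI prob_glue// !setTI hw.
  (* [D] meets the fibre of [f] over [s] in [B s] if [s] is in [r], and is
     disjoint from it otherwise. *)
  suff -> : prob (D `&` f @^-1` [set s]) = m s by rewrite addrC subrK.
  have [sr|sr] := boolP (s \in r).
    rewrite -pB; congr prob; apply/seteqP; split=> [t [[u _ Bu] fs]|t Bt].
      by have /= fu := Bf _ _ Bu; rewrite -fs /= fu.
    by split; [exists s|exact: Bf].
  rewrite mr// (_ : _ `&` _ = set0) ?prob_set0//.
  rewrite -subset0 => t [[u /= ur' Bu] fs].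
  by have /= fu := Bf _ _ Bu; move: sr; rewrite -fs fu ur'.
rewrite -pD -prob_setC//; apply: prob_mono => t /=.
by case: asboolP.
Qed.

(** As [f] lies in the finite list [r] almost everywhere, the set where [f] and
    [g] agree is, up to a null set, the finite disjoint union of the sets where
    both equal a given [s] in [r], each of measure at most either law at [s]. *)
Lemma overlap_le (f g : map) (r : seq S) : uniq r ->
  (\forall t \ae @lambda R, f t \in r) ->
  1 - \sum_(s <- r) Num.min (law f s) (law g s) <= prob [set t | f t <> g t].
Proof.
move=> ur fr; pose F s := f @^-1` [set s] `&` g @^-1` [set s].
have mF s : measurable (F s) by apply: measurableI; exact: measurable_mapP.
have tF : trivIset setT F by apply: (@trivIset_sub_fibers f) => s t [].
pose E := \bigcup_(s in [set` r]) F s.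
have mE : measurable E by apply: fin_bigcup_measurable.
apply: (@le_trans _ _ (prob (~` E))).
  rewrite prob_setC// lerD2l lerN2 prob_bigcup_seq//; apply: ler_sum => s _.
  by rewrite le_min; apply/andP; split; apply: prob_mono => t [].
apply: prob_le_ae; apply: filterS fr => t fr nE /= fg; apply: nE.
by exists (f t) => //; split => //=; rewrite fg.
Qed.

Lemma sum_law (f : map) (r : seq S) : uniq r ->
  (\forall t \ae @lambda R, f t \in r) -> \sum_(s <- r) law f s = 1.
Proof.
move=> ur fr; rewrite -prob_bigcup_seq//; last exact: trivIset_preimage1.
  rewrite -(prob_setT R); apply/eqP; rewrite eq_le prob_mono//=.
  by apply: prob_le_ae; apply: filterS fr => t fr _; exists (f t).
by move=> s; exact: measurable_mapP.
Qed.

Lemma law_out (f : map) (r : seq S) :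
  (\forall t \ae @lambda R, f t \in r) -> forall s, s \notin r -> law f s = 0.
Proof.
move=> fr s sr; apply/eqP; rewrite eq_le prob_ge0 -(prob_set0 R) andbT.
by apply: prob_le_ae; apply: filterS fr => t fr /= fs; rewrite -fs fr in sr.
Qed.

(** Converse of [sum_law]: a law determines whether almost all values lie in
    [r], so membership in a random complex can be read off the law. *)
Lemma ae_mem_of_sum_law (f : map) (r : seq S) : uniq r ->
  \sum_(s <- r) law f s = 1 -> \forall t \ae @lambda R, f t \in r.
Proof.
move=> ur f1; pose E := \bigcup_(s in [set` r]) f @^-1` [set s].
have mE : measurable E.
  by apply: fin_bigcup_measurable => // s _; exact: measurable_mapP.
exists (~` E); split; first exact: measurableC.
  rewrite [LHS]probE prob_setC// prob_bigcup_seq ?f1 ?subrr//.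
    by move=> s; exact: measurable_mapP.
  exact: trivIset_preimage1.
by move=> t /= ntr [s /= sr fs]; apply: ntr; rewrite fs.
Qed.

Lemma essential_imageE (f : map) : essential_image f = [set s | law f s != 0].
Proof.
by apply/seteqP; split => s;
  rewrite /essential_image /= probE lte_fin lt0r prob_ge0 andbT.
Qed.

Lemma law_repr_pi (f : map) : law (repr (\pi_(Lmap R S) f)) = law f.
Proof.
apply/funext => s; apply/eqP; rewrite eq_le; apply/andP; split;
  by apply: prob_le_ae; apply: filterS (repr_Lmap_ae f) => t /= ->.
Qed.

End Maps.

(** * The law as a submetry between the two realizations of a complex *)

Section Complexes.
Variables (R : realType) (S : choiceType).
Implicit Types (K : set (set S)) (u v : Lmap R S) (a b : S -> R).

Lemma finite_seq (A : set S) : finite_set A ->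
  exists2 r : seq S, uniq r & A = [set` r].
Proof.
move=> /finite_seqP[r ->]; exists (undup r); first exact: undup_uniq.
by apply/seteqP; split => s /=; rewrite mem_undup.
Qed.

Lemma random_complex_support K u : is_simplicial_complex K ->
  random_complex K u -> exists2 r : seq S, uniq r &
    [set s | law (repr u) s != 0] = [set` r] /\
    \forall t \ae @lambda R, repr u t \in r.
Proof.
move=> [_ Kfin _] [Ku uae]; have [fin _] := Kfin _ Ku.
have [r ur imr] := finite_seq fin; exists r => //.
by rewrite -essential_imageE imr in uae *.
Qed.

Lemma geometric_realization_support K a : is_simplicial_complex K ->
  geometric_realization K a -> exists r : seq S, [/\ uniq r,
    [set s | a s != 0] = [set` r], forall s, 0 <= a s,
    forall s, s \notin r -> a s = 0 & \sum_(s <- r) a s = 1].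
Proof.
move=> [_ Kfin _] [a01 a1 Ka]; have [fin _] := Kfin _ Ka.
have [r ur ar] := finite_seq fin.
have a0 s : 0 <= a s by case/andP: (a01 s).
have ar' s : s \notin r -> a s = 0.
  move=> sr; apply/eqP; apply: contraNT sr => as0.
  by have : [set s | a s != 0] s by []; rewrite ar.
exists r; split => //.
by apply: EFin_inj; rewrite -(esum_seq ur a0 ar') a1.
Qed.

Lemma law_geometric_realization K u : is_simplicial_complex K ->
  random_complex K u -> geometric_realization K (law (repr u)).
Proof.
move=> hK Ku; have [r ur [_ uae]] := random_complex_support hK Ku.
split.
- by move=> s; rewrite prob_ge0 -(prob_setT R) prob_mono.
- rewrite (esum_seq ur) ?sum_law//; first by move=> s; exact: prob_ge0.
  exact: law_out uae.
- by rewrite -essential_imageE; case: Ku.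
Qed.

Lemma random_complex_pi K (g : measurable_map R S) : is_simplicial_complex K ->
  geometric_realization K (law g) -> random_complex K (\pi_(Lmap R S) g).
Proof.
move=> hK Kg; have [r [ur gr _ _ g1]] := geometric_realization_support hK Kg.
rewrite /random_complex /= !essential_imageE law_repr_pi.
split; first by case: Kg.
rewrite gr.
by apply: filterS2 (repr_Lmap_ae g) (ae_mem_of_sum_law ur g1) => t /= ->.
Qed.

(** Both laws vanish off the concatenation of their supports, a finite list on
    which [half_l1_distE] and [overlap_le] meet. *)
Lemma half_l1_dist_law_le K K' u v :
  is_simplicial_complex K -> is_simplicial_complex K' ->
  random_complex K u -> random_complex K' v ->
  (half_l1_dist (law (repr u)) (law (repr v)) <= disagreement_dist u v)%E.
Proof.
move=> hK hK' Ku Kv.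
have [r1 _ [_ u1]] := random_complex_support hK Ku.
have [r2 _ [_ v2]] := random_complex_support hK' Kv.
pose r := undup (r1 ++ r2); have ur : uniq r by exact: undup_uniq.
have {}u1 : \forall t \ae @lambda R, repr u t \in r.
  by apply: filterS u1 => t; rewrite mem_undup mem_cat => ->.
have {}v2 : \forall t \ae @lambda R, repr v t \in r.
  by apply: filterS v2 => t; rewrite mem_undup mem_cat => ->; rewrite orbT.
rewrite (half_l1_distE ur (law_out u1) (law_out v2)) ?sum_law//.
by rewrite /disagreement_dist probE lee_fin overlap_le.
Qed.

(** [exists_coupled_map] for a representative of [u], on the joint support;
    passing to classes changes neither laws nor the disagreement measure. *)
Lemma half_l1_dist_lift K K' u b :
  is_simplicial_complex K -> is_simplicial_complex K' ->
  random_complex K u -> geometric_realization K' b ->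
  exists v, [/\ random_complex K' v, law (repr v) = b &
    (disagreement_dist u v <= half_l1_dist (law (repr u)) b)%E].
Proof.
move=> hK hK' Ku Kb.
have [r1 _ [_ u1]] := random_complex_support hK Ku.
have [r2 [u2 _ b0 br2 b1]] := geometric_realization_support hK' Kb.
pose r := undup (r1 ++ r2); have ur : uniq r by exact: undup_uniq.
have {}u1 : \forall t \ae @lambda R, repr u t \in r.
  by apply: filterS u1 => t; rewrite mem_undup mem_cat => ->.
have br s : s \notin r -> b s = 0.
  by rewrite mem_undup mem_cat negb_or => /andP[_]; exact: br2.
have {}b1 : \sum_(s <- r) b s = 1.
  by apply: EFin_inj; rewrite -(esum_seq ur b0 br) (esum_seq u2 b0 br2) b1.
have [g gb ug] :=
  exists_coupled_map (repr u (Omega_point R)) (repr u) ur b0 br b1.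
exists (\pi_(Lmap R S) g); split.
- by apply: random_complex_pi => //; rewrite gb.
- by rewrite law_repr_pi.
rewrite (half_l1_distE ur (law_out u1) br) ?sum_law//.
by rewrite -{1}[u]reprK disagreement_dist_pi probE lee_fin.
Qed.

(** The singleton of an element of a simplex is a simplex, and it is the
    essential image of a constant map. *)
Lemma random_complex_neq0 K : is_simplicial_complex K ->
  @random_complex R S K !=set0.
Proof.
move=> hK; have [[A KA] Kfin Ksub] := hK; have [_ [s As]] := Kfin _ KA.
exists (\pi_(Lmap R S) (constant_map R s)).
have lawE x : law (constant_map R s) x = (x == s)%:R.
  rewrite /law preimage_cst eq_sym; case: eqVneq => [->|sx].
    by rewrite mem_set// prob_setT.
  by rewrite memNset ?prob_set0// => /= /eqP; exact/negP.
apply: random_complex_pi => //; split.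
- by move=> x; rewrite lawE; case: eqP => _; rewrite /= ?lexx ?ler01.
- rewrite (@esum_seq _ _ [:: s])// ?big_seq1 ?lawE ?eqxx//.
    by move=> x; exact: prob_ge0.
  by move=> x; rewrite inE lawE => /negPf ->.
- apply: (Ksub _ _ KA) => [x /=|]; last first.
    by exists s; rewrite /= lawE eqxx oner_eq0.
  by rewrite lawE; case: (eqVneq x s) => [->//|_]; rewrite eqxx.
Qed.

(** Surjectivity comes from [half_l1_dist_lift] applied to any member of
    [L(K)], with the same complex as target. *)
Lemma image_law_random_complex K : is_simplicial_complex K ->
  (fun u => law (repr u)) @` @random_complex R S K = geometric_realization K.
Proof.
move=> hK; apply/seteqP; split=> [_ [u Ku <-]|b Kb].
  exact: law_geometric_realization.
have [u Ku] := random_complex_neq0 hK.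
by have [v [Kv vb _]] := half_l1_dist_lift hK hK Ku Kb; exists v.
Qed.

Lemma hausdorff_excess_law K K' :
  is_simplicial_complex K -> is_simplicial_complex K' ->
  hausdorff_excess (@disagreement_dist R S)
    (random_complex K) (random_complex K') =
  hausdorff_excess (@half_l1_dist R S)
    (geometric_realization K) (geometric_realization K').
Proof.
move=> hK hK'.
apply: (@hausdorff_excess_submetry _ _ _ _ _ (fun u => law (repr u))).
- exact: image_law_random_complex.
- by rewrite image_law_random_complex.
- by move=> u v Ku Kv; exact: half_l1_dist_law_le Ku Kv.
- move=> u b Ku Kb; have [v [Kv _ uv]] := half_l1_dist_lift hK hK' Ku Kb.
  by exists v.
Qed.

End Complexes.

Theorem corollary2p7 (R : realType) (S : choiceType) (K K' : set (set S))
    (hK : is_simplicial_complex K) (hK' : is_simplicial_complex K') :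
  hausdorff_dist (@half_l1_dist R S)
    (@geometric_realization R S K) (@geometric_realization R S K') =
  hausdorff_dist (@disagreement_dist R S)
    (@random_complex R S K) (@random_complex R S K').
Proof. by rewrite /hausdorff_dist !hausdorff_excess_law. Qed.
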